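(* Let $n\ge 2$, let $m$ and $k_1,\ldots,k_n$ be positive integers with $m+2\le\min\{k_1,\ldots,k_n\}$. For $i=1,\ldots,n$ let $G_i$ be an inflator graph of order $k_i$ with drop $m$, and let $M_i$ be an HCTV graph with $|V(M_i)|\ge m$. Let $F$ be the graph obtained from the cycle $C_n$ by inflating each vertex $v_i$ with $G_i$ and then inserting $M_i$ into each former edge $e_i$ of $C_n$. Then $F$ is a connected, nontraceable detour graph.
   Context: All graphs are finite and simple; the order of a path is its number of vertices. For a vertex $v$, $\tau(v)$ is the order of a longest path starting at $v$; a detour graph is one in which all vertices have the same $\tau(v)$; nontraceable means no hamiltonian path. $\tau_G(u,v)$ is the order of a longest $u$–$v$ path in $G$. Inflator graph with drop $m$: a graph $G$ of order $k\ge 3$ ($m\le k-2$) with two distinguished vertices $a,b$ such that (D-1) $\tau_G(a,b)=k-m$; (D-2) each distinguished vertex is an endvertex of a path containing all vertices except the other distinguished vertex; (D-3) $G$ has a hamiltonian path starting at each distinguished vertex; (D-4) for every $v\notin\{a,b\}$ there are disjoint paths $P$ from $v$ to one distinguished vertex and $Q$ with the other distinguished vertex as an endvertex ($Q$ possibly a single vertex) with $V(P)\cup V(Q)=V(G)$. HCTV graph: either $K_1$, or a graph with two vertices $x,y$ (anchors) such that every vertex is an endvertex of a hamiltonian path whose other endvertex is $x$ or $y$. Construction: $C_n$ has vertices $v_1,\ldots,v_n$ and edges $e_i=v_iv_{i+1}$ (indices mod $n$; for $n=2$, $C_2$ has two parallel edges between $v_1,v_2$). Inflating $v_i$ with $G_i$: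 delete $v_i$, add a copy of $G_i$, and join the two former neighbours (edge-ends) of $v_i$ to the two distinguished vertices of $G_i$ by a matching, using the two edges formerly incident with $v_i$. Inserting $M_i$ into an edge $e$: delete $e$ and join its two endvertices to the two anchors of $M_i$ by a matching if $M_i\ne K_1$, or both to the single vertex of $M_i$ if $M_i=K_1$. *)

(* Defs.v *)
From mathcomp Require Import all_boot.
Set Implicit Arguments. Unset Strict Implicit. Unset Printing Implicit Defensive.

Record sgraph := SGraph {
  vert :> finType;
  adj : rel vert;
  adj_sym : symmetric adj;
  adj_irr : irreflexive adj }.

Section Paths.
Variables (V : finType) (e : rel V).

Definition path_from (v : V) (s : seq V) : bool := path e v s && uniq (v :: s).

Definition tau (v : V) : nat :=
  \max_(i < #|V|) (if [exists t : i.-tuple V, path_from v t] then i.+1 else 0).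

Definition tau2 (u w : V) : nat :=
  \max_(i < #|V|)
     (if [exists t : i.-tuple V, path_from u t && (last u t == w)] then i.+1 else 0).

Definition detour_graph : Prop := forall u v : V, tau u = tau v.

Definition hamiltonian_path_from (v : V) (s : seq V) : Prop :=
  path_from v s /\ forall w, w \in v :: s.

Definition traceable : Prop := exists v s, hamiltonian_path_from v s.
Definition nontraceable : Prop := ~ traceable.

Definition connected_graph : Prop := forall u v : V, connect e u v.

End Paths.

Definition inflator (G : sgraph) (a b : G) (k m : nat) : Prop :=
  [/\ a != b /\ #|G| = k /\ 3 <= k /\ m <= k - 2,
   tau2 (@adj G) a b = k - m,
   ((exists s, path_from (@adj G) a s /\ forall w, (w \in a :: s) = (w != b)) /\
    (exists s, path_from (@adj G) b s /\ forall w, (w \in b :: s) = (w != a))),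
   ((exists s, hamiltonian_path_from (@adj G) a s) /\
    (exists s, hamiltonian_path_from (@adj G) b s)) &
   forall v : G, v != a -> v != b ->
     exists (d1 d2 : G) (p q : seq G),
       [/\ ((d1 == a) && (d2 == b)) || ((d1 == b) && (d2 == a)),
           path_from (@adj G) v p /\ last v p = d1,
           path_from (@adj G) d2 q,
           (forall w, ~~ ((w \in v :: p) && (w \in d2 :: q))) &
           (forall w, (w \in v :: p) || (w \in d2 :: q))]].

Definition HCTV (M : sgraph) (x y : M) : Prop :=
  (#|M| = 1 /\ x = y) \/
  (x != y /\ forall v : M, exists s,
      hamiltonian_path_from (@adj M) v s /\ ((last v s == x) || (last v s == y))).

(* The construction: vertices of F are the copies of the G_i and of the M_i.
   Cycle edge e_i = v_i v_{i+1} (indices mod n, i.e. ordS). After inflation,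
   e_i joins b_i (in G_i) to a_{i+1} (in G_{i+1}); inserting M_i into e_i
   joins b_i to the anchor x_i and y_i to a_{i+1}. *)
Section Construction.
Variables (n : nat) (G M : 'I_n -> sgraph)
  (a b : forall i, G i) (x y : forall i, M i).

Definition FV : finType := ({i : 'I_n & G i} + {i : 'I_n & M i})%type.

Definition Flink (u : {i : 'I_n & G i}) (w : {i : 'I_n & M i}) : bool :=
  ((tag w == tag u) && (tagged u == b (tag u)) && (tagged w == x (tag w)))
  || ((ordS (tag w) == tag u) && (tagged u == a (tag u)) && (tagged w == y (tag w))).

Definition Fadj : rel FV := fun p q =>
  match p, q with
  | inl u, inl w => (tag u == tag w) && adj (tagged u) (tagged_as u w)
  | inr u, inr w => (tag u == tag w) && adj (tagged u) (tagged_as u w)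
  | inl u, inr w => Flink u w
  | inr w, inl u => Flink u w
  end.

End Construction.

(* Main.v *)
Require Import Defs.
From mathcomp Require Import all_boot.
From mathcomp Require Import zify.
Set Implicit Arguments. Unset Strict Implicit. Unset Printing Implicit Defensive.

(* F is a ring of 2n blocks, alternately G_i and M_i, in which consecutive blocks
   are joined by a single edge.  Put N = |V(F)| - (n-1)m; every vertex has tau = N.
   - Upper bound.  A path visiting a block that contains none of its ends crosses
     it exactly once, between its two ports; so it misses at least m vertices of
     each G_i containing no end.  This suffices unless the ends lie in distinct
     G_i and G_j.  In that case the path leaves G_i for good through one port, so
     it cannot enter the M-block next to the other port: it misses all of that
     block, which has at least m vertices.
   - Lower bound.  Go once around the ring, crossing each G_j but one along a
     longest a_j-b_j path and each M_j along a hamiltonian path, starting in one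
     part of the remaining G_i and finishing in the other.  When the starting
     vertex is in some M_j, start there instead and finish by a hamiltonian path
     of the neighbouring G_i. *)

(** * Ends of lists and junctions between them *)

Section Lists.
Variables (T : eqType) (e : rel T).

Definition olast (s : seq T) : option T := ohead (rev s).

(** Vacuous when either list is empty, so a tour may have an empty first or last piece without a
    separate case. *)
Definition linked (s1 s2 : seq T) : Prop :=
  forall u w, olast s1 = Some u -> ohead s2 = Some w -> e u w.

Lemma olast_rcons s v : olast (rcons s v) = Some v.
Proof. by rewrite /olast rev_rcons. Qed.

Lemma olast_cons v s : olast (v :: s) = Some (last v s).
Proof. by rewrite lastI olast_rcons. Qed.

Lemma ohead_cat (s1 s2 : seq T) :
  ohead (s1 ++ s2) = if s1 is [::] then ohead s2 else ohead s1.
Proof. by case: s1. Qed.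

Lemma olast_cat (s1 s2 : seq T) :
  olast (s1 ++ s2) = if s2 is [::] then olast s1 else olast s2.
Proof.
rewrite /olast rev_cat ohead_cat; case: s2 => // v s2.
by rewrite rev_cons; case: (rev s2).
Qed.

Lemma olast_rev s : olast (rev s) = ohead s.
Proof. by rewrite /olast revK. Qed.

Lemma sorted_cat_linked s1 s2 :
  sorted e s1 -> sorted e s2 -> linked s1 s2 -> sorted e (s1 ++ s2).
Proof.
case: s1 => // u s1 /= e1; case: s2 => [|w s2 e2 lk]; first by rewrite cats0.
rewrite cat_path e1 /=; move: e2 => /= ->; rewrite andbT.
by apply: lk; rewrite ?olast_cons.
Qed.

Lemma sorted_revE s : symmetric e -> sorted e (rev s) = sorted e s.
Proof. by move=> se; rewrite rev_sorted; apply: eq_sorted => u w; rewrite se. Qed.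

(** As no segment is empty, whatever follows [seg D] begins with the head of [seg (f D)]; links
    between successive segments are therefore enough. *)
Lemma sorted_flatten (K : eqType) (f : K -> K) (seg : K -> seq T) C L p :
  path (frel f) C L ->
  (forall D, D \in C :: L -> seg D != [::] /\ sorted e (seg D)) ->
  (forall D, D \in C :: L -> f D \in L -> linked (seg D) (seg (f D))) ->
  sorted e p -> linked (seg (last C L)) p ->
  sorted e (flatten (map seg (C :: L)) ++ p).
Proof.
elim: L C => [|D L IH] C /= pth hseg hlk sp lkp.
  rewrite cats0; apply: sorted_cat_linked => //.
  by have [] := hseg C; rewrite ?mem_head.
case/andP: pth => /eqP fC pth.
have hL E : E \in D :: L -> E \in C :: D :: L by move=> EL; rewrite inE EL orbT.
rewrite -catA; apply: sorted_cat_linked.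
- by have [] := hseg C; rewrite ?mem_head.
- apply: IH => // E EL; first exact/hseg/hL.
  by move=> fE; apply: hlk; rewrite ?hL // inE fE orbT.
move=> u w hu hw; have := hlk C; rewrite fC !mem_head => /(_ isT isT u w hu); apply.
move: hw; rewrite -catA ohead_cat.
by have [+ _] := hseg D (hL _ (mem_head _ _)); case: (seg D).
Qed.

Lemma uniq_flatten (K : eqType) (blk : T -> K) (seg : K -> seq T) L :
  uniq L -> (forall D, D \in L -> uniq (seg D)) ->
  (forall D, D \in L -> forall v, v \in seg D -> blk v = D) ->
  uniq (flatten (map seg L)).
Proof.
elim: L => //= C L IH /andP[CL uL] us bs.
rewrite cat_uniq us ?mem_head //= IH // => [|D DL|D DL].
- rewrite andbT; apply/hasPn => v /flatten_mapP[D DL vD].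
  apply/negP => vC; move: CL; rewrite -(bs C _ v) ?mem_head //.
  by rewrite (bs D _ v) ?DL // inE DL orbT.
- by rewrite us // inE DL orbT.
by apply: bs; rewrite inE DL orbT.
Qed.

(* A walk that starts inside a set [A] and never re-enters it crosses the
   boundary of [A] only once, at the junction of [q] and [r :: s]. *)
Lemma crossing_unique (A : pred T) (q s s1 s2 : seq T) r c d :
  all A q -> all (predC A) (r :: s) -> q ++ r :: s = s1 ++ c :: d :: s2 ->
  A c != A d -> A c /\ d = r.
Proof.
elim: s1 q => [|z s1 IH] [|y q] /=.
- move=> _ /andP[nr ns] [<- es].
  have : d \in s by rewrite es mem_head.
  by move/(allP ns) => /=; rewrite (negbTE nr) => /negbTE->.
- case/andP=> Ay Aq /andP[nr ns] [<-].
  case: q Aq => [_ [<- _]|y' q /= /andP[Ay' _] [<- _]]; first by rewrite Ay.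
  by rewrite Ay Ay'.
- move=> _ /andP[nr ns] [_ es].
  have cs : c \in s by rewrite es mem_cat mem_head orbT.
  have ds : d \in s by rewrite es mem_cat !inE eqxx !orbT.
  by rewrite (negbTE (allP ns _ cs)) (negbTE (allP ns _ ds)).
by case/andP=> _ Aq nrs [_ es]; apply: IH es.
Qed.

End Lists.

Lemma ohead_map (T U : Type) (h : T -> U) s : ohead (map h s) = omap h (ohead s).
Proof. by case: s. Qed.

Lemma olast_map (T U : eqType) (h : T -> U) s : olast (map h s) = omap h (olast s).
Proof. by rewrite /olast -map_rev ohead_map. Qed.

(** * Paths in a ring of blocks *)

Section Ring.
Variables (V K : finType) (e : rel V) (blk : V -> K).
Variables (f g : K -> K) (en ex : K -> V).
Hypothesis e_sym : symmetric e.
Hypotheses (fK : cancel f g) (gK : cancel g f).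
Hypotheses (blk_en : forall C, blk (en C) = C) (blk_ex : forall C, blk (ex C) = C).

(** The two edges that join block [C] to the rest of the ring, oriented outwards. *)
Definition port C u w :=
  (u = ex C /\ w = en (f C)) \/ (u = en C /\ w = ex (g C)).

Hypothesis cross : forall u w, e u w -> blk u != blk w -> port (blk u) u w.
Hypotheses (fN : forall C, f C != C) (fgN : forall C, f C != g C).

(** The path is cut at its first entry [c] into [C] and at its next exit to [r]. The inequality is
    stated for the outer vertices [l] and [r], because in a one-vertex block the inner ends coincide
    although the two ports are distinct. *)
Lemma path_through_block u t C : path_from e u t -> blk u != C -> blk (last u t) != C ->
  (forall v, v \in u :: t -> blk v != C) \/
  exists s1 l c p r s2,
    [/\ u :: t = s1 ++ l :: c :: p ++ r :: s2,
        forall v, v \in c :: p -> blk v = C,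
        forall v, v \in s1 ++ l :: r :: s2 -> blk v != C &
        (port C c l /\ port C (last c p) r) /\ l != r].
Proof.
rewrite /path_from; set A := fun v => blk v == C.
move=> + uC; have [|nA _ _] := boolP (has A t); last first.
  left=> v; rewrite inE => /predU1P[->//|vt].
  by apply: contra nA => vC; apply/hasP; exists v.
case/split_find => c s1 s2 /eqP cC ns1.
rewrite last_cat last_rcons cat_path rcons_path last_rcons -andbA -andbA.
case/and4P=> _ elc e2 uq; have [|nB lC] := boolP (has (predC A) s2); last first.
  have := mem_last c s2; rewrite inE => /predU1P[lc|ls].
    by rewrite lc cC eqxx in lC.
  by case/negP: nB; apply/hasP; exists (last c s2).
move: e2 uq => /[swap] + + hr; case/split_find: hr => r q s3 /= rC nq.
rewrite cat_path rcons_path last_rcons -andbA => uq /and3P[_ eqr e3] _.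
have lC : blk (last u s1) != C.
  have := mem_last u s1; rewrite inE => /predU1P[->//|ls].
  by apply: contra ns1 => h; apply/hasP; exists (last u s1).
have qC v : v \in c :: q -> blk v = C.
  rewrite inE => /predU1P[->//|vq]; apply/eqP/negP => /negP h.
  by case/negP: nq; apply/hasP; exists v.
have kC : blk (last c q) = C by apply/qC/mem_last.
have pc : port C c (last u s1).
  by rewrite -cC; apply: cross; [rewrite e_sym | rewrite cC eq_sym].
have pk : port C (last c q) r.
  by rewrite -{1}kC; apply: cross; rewrite // kC eq_sym.
have perm : perm_eq (u :: rcons s1 c ++ rcons q r ++ s3)
                    ((u :: s1) ++ (c :: q) ++ (r :: s3)).
  by rewrite -!cats1 -!catA.
move: uq; rewrite -cons_uniq (perm_uniq perm) cat_uniq => /and3P[_ h1].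
rewrite cat_uniq => /and3P[_ h2 _].
have lr : last u s1 != r.
  apply: contra h1 => /eqP lr; apply/hasP; exists r.
    by rewrite !mem_cat mem_head orbT.
  by rewrite /= -lr mem_last.
right; exists (belast u s1), (last u s1), c, q, r, s3; split => //.
- by rewrite -(cat1s c) -(cat1s r) -!cat_rcons -lastI -!cats1 -!catA.
move=> v; rewrite -cat_rcons -lastI mem_cat => /orP[|].
  rewrite inE => /predU1P[->//|vs].
  by apply: contra ns1 => h; apply/hasP; exists v.
rewrite inE => /predU1P[->//|]; apply/contraL => vC.
(* A second entry [c'] would be [en C] or [ex C]. Since [l != r], the first passage used both ports,
   so [c'] already occurs in [c :: q], against uniqueness. *)
apply/negP => vs3; have : has A s3 by apply/hasP; exists v.
move=> h3; case/split_find: h3 e3 h2 => c' s4 s5 /eqP c'C ns4.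
rewrite cat_path rcons_path -andbA => /and3P[_ ec' _] /hasPn h2.
have lC' : blk (last r s4) != C.
  have := mem_last r s4; rewrite inE => /predU1P[->//|ls].
  by apply: contra ns4 => h; apply/hasP; exists (last r s4).
have pc' : port C c' (last r s4).
  by rewrite -c'C; apply: cross; [rewrite e_sym | rewrite c'C eq_sym].
have c'q : c' \notin c :: q.
  by apply: h2; rewrite inE mem_cat mem_rcons mem_head orbT.
case: pc pk pc' c'q => [[-> el]|[-> el]] [[ek er]|[ek er]] [[q' _]|[q' _]];
  try (by rewrite el er eqxx in lr);
  by rewrite q' -?ek ?mem_head ?mem_last.
Qed.

Lemma ports_distinct C c l k r : port C c l -> port C k r -> l != r ->
  [/\ c = en C, l = ex (g C), k = ex C & r = en (f C)] \/
  [/\ c = ex C, l = en (f C), k = en C & r = ex (g C)].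
Proof.
move=> [[-> ->]|[-> ->]] [[-> ->]|[-> ->]]; rewrite ?eqxx // => _;
  by [left | right].
Qed.

Definition consecutive (s : seq V) c d :=
  (exists s1 s2, s = s1 ++ c :: d :: s2) \/ (exists s1 s2, s = s1 ++ d :: c :: s2).

(** A path that visits [C] without ending there comes in by one port and goes out by the other, so
    it uses both port edges. *)
Lemma path_through_block_consecutive u t C v c d : path_from e u t ->
  blk u != C -> blk (last u t) != C -> v \in u :: t -> blk v = C ->
  port C c d -> consecutive (u :: t) c d.
Proof.
move=> pt uC tC vs vC pcd; have [nv|] := path_through_block pt uC tC.
  by move: (nv v vs); rewrite vC eqxx.
case=> [s1 [l [c0 [p [r [s2 [-> _ _ [[p1 p2] lr]]]]]]]].
have H1 : consecutive (s1 ++ [:: l, c0 & p ++ r :: s2]) c0 l.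
  by right; exists s1, (p ++ r :: s2).
have H2 : consecutive (s1 ++ [:: l, c0 & p ++ r :: s2]) (last c0 p) r.
  left; exists (s1 ++ l :: belast c0 p), s2.
  by rewrite -(cat_rcons (last c0 p)) rcons_cat rcons_cons -lastI -catA.
by case: (ports_distinct p1 p2 lr) H1 H2 => -[-> -> -> ->];
  case: pcd => -[-> ->].
Qed.

(** The path leaves its first block [C] once, along one edge to some [r]. Visiting a neighbour of
    [C] that contains no end forces the edge between that neighbour and [C]; if both neighbours were
    visited, [r] would lie in [f C] and in [g C], which differ. *)
Lemma path_misses_neighbour u t : path_from e u t ->
  (forall C, C \in [:: blk u; f (blk u); g (blk u)] -> blk (last u t) != C) ->
  (forall v, v \in u :: t -> blk v != f (blk u)) \/
  (forall v, v \in u :: t -> blk v != g (blk u)).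
Proof.
move=> pt tN; set C := blk u; have tC : blk (last u t) != C by rewrite tN ?mem_head.
have gN D : D != g D by apply: contra (fN D) => /eqP gD; rewrite {1}gD gK.
have [r [q [s3 [et qC rC kr nret]]]] : exists r q s3, [/\ t = q ++ r :: s3,
    all (fun v => blk v == C) (u :: q), blk r != C, port C (last u q) r &
    all (predC (fun v => blk v == C)) (r :: s3)].
  have : has (predC (fun v => blk v == C)) t.
    have := mem_last u t; rewrite inE => /predU1P[lu|lt].
      by rewrite lu eqxx in tC.
    by apply/hasP; exists (last u t).
  move=> h; case/split_find: h pt tC => r q s3 rC nq.
  rewrite /path_from last_cat last_rcons cat_path rcons_path last_rcons -andbA -andbA.
  case/and4P=> [_ eqr e3 uq] tC.
  have qC : all (fun v => blk v == C) (u :: q).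
    rewrite /= eqxx /=; apply: contraR nq; rewrite -has_predC.
    by apply.
  have kC : blk (last u q) = C by apply/eqP/(allP qC)/mem_last.
  have kr : port C (last u q) r by rewrite -kC; apply: cross; rewrite // kC eq_sym.
  exists r, q, s3; rewrite -cats1 -catA; split=> //.
  move: uq; rewrite -cats1 -catA -cat_cons cat_uniq => /and3P[_ dj u3].
  apply/allP => v vs; apply/negP => /eqP vC.
  have pr : path_from e r s3 by rewrite /path_from e3.
  (* A return would make the part from [r] on pass through [C], using both ports and hence meeting
     [last u q] again. *)
  have ink : last u q \in r :: s3.
    by case: (path_through_block_consecutive pr rC tC vs vC kr) => -[s1 [s2 ->]];
       rewrite mem_cat !inE eqxx ?orbT.
  by move/hasPn: dj => /(_ _ ink) /=; rewrite mem_last.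
(* Every step of the path across the boundary of [C], in either direction, has [r] as its outer
   vertex. *)
have exit c d : consecutive (u :: t) c d -> blk c = C -> blk d != C -> d = r.
  move=> + cC dC; case=> -[s1 [s2]]; rewrite et -cat_cons => es.
    by case: (crossing_unique qC nret es); rewrite // cC eqxx (negbTE dC).
  case: (crossing_unique qC nret es); last by rewrite (negbTE dC).
  by rewrite cC eqxx (negbTE dC).
have [h1|/allPn[v1 v1s]] := boolP (all (fun v => blk v != f C) (u :: t)).
  by left; apply/allP.
rewrite negbK => /eqP v1C; right => v2 v2s; apply/negP => /eqP v2C.
have r1 : en (f C) = r.
  apply: (exit (ex C)); rewrite ?blk_ex ?blk_en //.
  have := @path_through_block_consecutive u t (f C) v1 (en (f C)) (ex C) pt.
  rewrite eq_sym fN tN ?inE ?eqxx ?orbT // => /(_ isT isT v1s v1C) [|h|h].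
  - by right; rewrite fK.
  - by right.
  - by left.
have r2 : ex (g C) = r.
  apply: (exit (en C)); rewrite ?blk_ex ?blk_en 1?eq_sym //.
  have := @path_through_block_consecutive u t (g C) v2 (ex (g C)) (en C) pt.
  rewrite gN tN ?inE ?eqxx ?orbT // => /(_ isT isT v2s v2C) [|h|h].
  - by left; rewrite gK.
  - by right.
  - by left.
by have := fgN C; rewrite -(blk_en (f C)) r1 -r2 blk_ex eqxx.
Qed.

(** * Tours once around the ring *)

Hypothesis conn : forall C D, fconnect f C D.

(** The tour starts with [p1] in [C], runs through the chosen segments of the other blocks in the
    order of [f], and comes back to [C] for [p2]. Either piece may be empty, and then the tour
    starts or stops in a neighbouring block. *)
Lemma ring_tour (seg : K -> seq V) C p1 p2 :
  sorted e p1 -> sorted e p2 -> uniq (p1 ++ p2) ->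
  (forall v, v \in p1 ++ p2 -> blk v = C) ->
  (forall D, D != C -> seg D != [::] /\ sorted e (seg D)) ->
  (forall D, D != C -> uniq (seg D)) ->
  (forall D, D != C -> forall v, v \in seg D -> blk v = D) ->
  linked e p1 (seg (f C)) -> linked e (seg (g C)) p2 ->
  (forall D, D != C -> f D != C -> linked e (seg D) (seg (f D))) ->
  exists W, [/\ sorted e W, uniq W,
    size W = size (p1 ++ p2) + \sum_(D | D != C) size (seg D),
    ohead W = (if p1 is [::] then ohead (seg (f C)) else ohead p1) &
    olast W = (if p2 is [::] then olast (seg (g C)) else olast p2)].
Proof.
move=> sp1 sp2 up bp hseg useg bseg lk1 lk2 lkD.
have inj_f : injective f := can_inj fK.
have := cycle_orbit inj_f C; have := orbit_uniq f C.
have : orbit f C =i predT by move=> D; rewrite -fconnect_orbit conn.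
(* [L] is the orbit of [C] without [C] itself: it runs from [f C] to [g C] and meets every other
   block once. *)
rewrite /orbit -orderSpred /=; set L := traject f (f C) _ => memL.
case/andP=> CL uL; rewrite rcons_path => /andP[pthL /eqP lastL].
have inL D : (D \in L) = (D != C).
  have := memL D; rewrite inE; case: eqVneq => [->|] //= _.
  by rewrite (negbTE CL).
case EL: L => [|D0 L'].
  by have := inL (f C); rewrite fN EL.
have D0E : D0 = f C by move: pthL; rewrite EL /= => /andP[/eqP].
have lastE : last D0 L' = g C by rewrite -lastL fK EL.
exists (p1 ++ flatten (map seg L) ++ p2); split.
- apply: sorted_cat_linked => //.
    rewrite EL; apply: (@sorted_flatten _ _ _ f).
    - by move: pthL; rewrite EL /= => /andP[].
    - by move=> D; rewrite -EL inL; apply: hseg.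
    - move=> D; rewrite -EL inL => DC fDL; apply: lkD => //.
      by rewrite -inL EL inE fDL orbT.
    - by [].
    by rewrite lastE.
  move=> v w hv; rewrite EL /= -catA ohead_cat D0E => hw; apply: lk1 => //.
  by case: (hseg (f C)) hw => //; case: (seg (f C)).
- have : perm_eq (flatten (map seg L) ++ p1 ++ p2) (p1 ++ flatten (map seg L) ++ p2).
    by rewrite perm_catCA.
  move/perm_uniq <-; rewrite cat_uniq up andbT (@uniq_flatten _ _ blk) //=.
  + apply/hasPn => v /bp vC; apply/negP => /flatten_mapP[D].
    by rewrite inL => DC /(bseg D DC) vD; rewrite -vD vC eqxx in DC.
  + by move=> D; rewrite inL; apply: useg.
  by move=> D; rewrite inL; apply: bseg.
- rewrite !size_cat size_flatten /shape -map_comp sumnE big_map big_uniq //=.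
  by rewrite (eq_bigl _ _ inL) [in RHS]addnAC addnA.
- rewrite ohead_cat; case: p1 {sp1 up bp lk1} => //.
  rewrite EL D0E /= -catA ohead_cat.
  by case: (hseg (f C)) => //; case: (seg (f C)).
rewrite catA olast_cat; case: p2 {sp2 up bp lk2} => //.
have gN : g C != C by rewrite -inL EL -lastE mem_last.
rewrite EL lastI map_rcons flatten_rcons catA olast_cat lastE.
by case: (hseg (g C)) => //; case: (seg (g C)).
Qed.

End Ring.

(** * Inflators and HCTV graphs *)

Section Graphs.
Variables (V : finType) (e : rel V).
Hypothesis e_sym : symmetric e.

Definition walk p u w :=
  [/\ sorted e p, uniq p, ohead p = Some u & olast p = Some w].

Lemma walk_rev p u w : walk p u w -> walk (rev p) w u.
Proof.
case=> sp up hp lp; split; rewrite ?rev_uniq ?sorted_revE //.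
by rewrite olast_rev.
Qed.

Lemma path_from_walk v t : path_from e v t -> walk (v :: t) v (last v t).
Proof. by case/andP=> pt ut; split=> //; rewrite olast_cons. Qed.

Lemma walk_path_from p u w : walk p u w ->
  exists t, [/\ p = u :: t, path_from e u t & last u t = w].
Proof.
case: p => [|z t] [] //= pt ut [<-]; rewrite olast_cons => -[lt].
by exists t; rewrite /path_from pt.
Qed.

Lemma uniq_size_le (s : seq V) : uniq s -> size s <= #|V|.
Proof. by move/card_uniqP <-; apply: max_card. Qed.

Lemma uniq_size_full (s : seq V) : uniq s -> (forall w, w \in s) -> size s = #|V|.
Proof. by move/card_uniqP <- => h; apply: eq_card => w; rewrite h. Qed.

Lemma tau_eq v N : (exists t, path_from e v t /\ (size t).+1 = N) ->
  (forall t, path_from e v t -> size t < N) -> tau e v = N.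
Proof.
move=> [t [pt <-]] ub; apply/eqP; rewrite eqn_leq; apply/andP; split.
  apply/bigmax_leqP => i _; case: existsP => // -[s ps].
  by have := ub _ ps; rewrite size_tuple.
have lt : size t < #|V| by case/andP: pt => _ /uniq_size_le.
apply: (bigmax_sup (Ordinal lt)) => //=; case: existsP => // -[].
by exists (in_tuple t).
Qed.

Lemma tau2_ge p u w : walk p u w -> size p <= tau2 e u w.
Proof.
case/walk_path_from => t [-> pt lt]; have st : size t < #|V|.
  by case/andP: pt => _ /uniq_size_le.
apply: (bigmax_sup (Ordinal st)) => //=; case: existsP => // -[].
by exists (in_tuple t); rewrite /= pt lt eqxx.
Qed.

(** The value 0 stands for the absence of a path, so positivity is what provides one. *)
Lemma tau2_attained u w : 0 < tau2 e u w ->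
  exists p, walk p u w /\ size p = tau2 e u w.
Proof.
rewrite /tau2 => gt0.
have [|i0 E] := @eq_bigmax 'I_#|V| (fun i : 'I_#|V| =>
  if [exists t : i.-tuple V, path_from e u t && (last u t == w)] then i.+1 else 0).
  by rewrite card_ord; apply/card_gt0P; exists u.
move: gt0; rewrite E; case: existsP => // -[t /andP[pt /eqP lt]] _.
exists (u :: t); rewrite /= size_tuple; split=> //.
by rewrite -lt; apply: path_from_walk.
Qed.

Lemma hamiltonian_walk v s : hamiltonian_path_from e v s ->
  walk (v :: s) v (last v s) /\ size (v :: s) = #|V|.
Proof.
case=> ps all_s; split; first exact: path_from_walk.
by apply: uniq_size_full => //; case/andP: ps.
Qed.

Lemma hamiltonian_connected v s : hamiltonian_path_from e v s -> connected_graph e.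
Proof.
move=> [/andP[ps _] all_s]; have cv w : connect e v w.
  exact: (path_connect ps (all_s w)).
by move=> u w; apply: (connect_trans _ (cv w)); rewrite (sym_connect_sym e_sym).
Qed.

End Graphs.

Section Inflators.
Variables (G : sgraph) (a b : G) (k m : nat).
Hypothesis inflG : inflator a b k m.
Let e := @adj G.
Let e_sym : symmetric e := @adj_sym G.

Lemma inflator_cross : exists p, walk e p a b /\ size p + m = #|G|.
Proof.
have [[ab [cG [k3 mk]]] t2 _ _ _] := inflG.
have [|p [wp sp]] := @tau2_attained _ e a b; first by rewrite t2; lia.
by exists p; split=> //; rewrite sp t2 cG; lia.
Qed.

Lemma inflator_cross_le p : walk e p a b \/ walk e p b a -> size p + m <= #|G|.
Proof.
have [[ab [cG [k3 mk]]] t2 _ _ _] := inflG => wp.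
suff : size p <= k - m by rewrite cG; lia.
rewrite -t2; case: wp => [|/(walk_rev e_sym)] /tau2_ge //.
by rewrite size_rev.
Qed.

Lemma inflator_span_a :
  exists p, [/\ sorted e p, uniq p, size p = #|G| & ohead p = Some a].
Proof.
have [_ _ _ [[s /hamiltonian_walk[[? ? ? _] ?]] _] _] := inflG.
by exists (a :: s).
Qed.

Lemma inflator_span_b :
  exists p, [/\ sorted e p, uniq p, size p = #|G| & olast p = Some b].
Proof.
have [_ _ _ [_ [s /hamiltonian_walk[/(walk_rev e_sym)[? ? _ lp] ?]]] _] := inflG.
by exists (rev (b :: s)); rewrite size_rev.
Qed.

(** Prepares a tour that leaves through [b] after [p1] and returns through [a] into [p2], with [v]
    at a free end. Condition (D-2) serves [v = a] and [v = b], the other distinguished vertex being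
    covered by a one-vertex piece; (D-4) serves all other [v]. *)
Lemma inflator_split v : exists p1 p2,
  [/\ sorted e p1, sorted e p2, uniq (p1 ++ p2) & size (p1 ++ p2) = #|G|] /\
  [/\ olast p1 = Some b, ohead p2 = Some a &
      ohead p1 = Some v \/ olast p2 = Some v].
Proof.
have [_ _ [[sa [pa ha]] [sb [pb hb]]] _ D4] := inflG.
have [->|va] := eqVneq v a.
  exists (rev (b :: sb)), [:: a].
  have u : uniq (rev (b :: sb) ++ [:: a]).
    rewrite cats1 rcons_uniq mem_rev hb eqxx rev_uniq.
    by case/andP: pb.
  have [? _ _ ?] := walk_rev e_sym (path_from_walk pb).
  split; split=> //; last by right.
  apply: uniq_size_full => // w; rewrite cats1 mem_rcons inE mem_rev hb.
  exact: orbN.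
have [->|vb] := eqVneq v b.
  exists [:: b], (a :: sa).
  have u : uniq ([:: b] ++ a :: sa).
    by rewrite cons_uniq ha eqxx; case/andP: pa.
  have [? _ ? _] := path_from_walk pa.
  split; split=> //; last by left.
  by apply: uniq_size_full => // w; rewrite inE ha; apply: orbN.
have [d1 [d2 [p [q [d12 [pp lp] pq dj cov]]]]] := D4 v va vb.
have [s1 u1 h1 l1] := path_from_walk pp; have [s2 u2 h2 l2] := path_from_walk pq.
have u : uniq ((v :: p) ++ d2 :: q).
  rewrite cat_uniq u1 u2 andbT; apply/hasPn => w wq; apply/negP => wp.
  by have := dj w; rewrite wp wq.
have full : size ((v :: p) ++ d2 :: q) = #|G|.
  by apply: uniq_size_full => // w; rewrite mem_cat cov.
(* If the path from [v] reaches [a], both pieces are reversed and [v] becomes the last vertex; if it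
   reaches [b], [v] is the first one. *)
case/orP: d12 => /andP[/eqP d1E /eqP d2E].
  exists (rev (d2 :: q)), (rev (v :: p)).
  rewrite -rev_cat rev_uniq size_rev full !sorted_revE // !olast_rev.
  by split; split=> //; rewrite ?d2E // -?d1E -?lp //; right.
exists (v :: p), (d2 :: q).
by split; split=> //; rewrite ?d2E // -?d1E -?lp //; left.
Qed.

End Inflators.

Section HCTVs.
Variables (M : sgraph) (x y : M).
Hypothesis hM : HCTV x y.
Let e := @adj M.
Let e_sym : symmetric e := @adj_sym M.

(** When [x != y], a hamiltonian path from [x] cannot end at [x]: it would be a single vertex and
    miss [y]. *)
Lemma HCTV_cross : exists p, walk e p x y /\ size p = #|M|.
Proof.
case: hM => [[c1 <-]|[xy hv]]; first by exists [:: x].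
have [s [hs lxy]] := hv x; exists (x :: s).
have [ws ss] := hamiltonian_walk hs; split=> //.
case/orP: lxy ws => [/eqP lx|/eqP->] //.
case: hs => /andP[_ ux] full; have := full y.
case: s lx ux {ss full} => [|z s] /=; first by rewrite inE eq_sym (negbTE xy).
by move=> lz; rewrite -{1}lz mem_last.
Qed.

Lemma HCTV_span v : exists p, size p = #|M| /\ (walk e p v y \/ walk e p x v).
Proof.
case: hM => [[c1 <-]|[xy hv]].
  have -> : v = x by apply: (card_le1_eqP (A := predT)); rewrite ?c1.
  by exists [:: x]; split=> //; left.
have [s [hs lxy]] := hv v; have [ws ss] := hamiltonian_walk hs.
case/orP: lxy ws => /eqP-> ws; last by exists (v :: s); split=> //; left.
by exists (rev (v :: s)); rewrite size_rev; split=> //; right; apply: walk_rev.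
Qed.

Lemma HCTV_connected : connected_graph e.
Proof.
case: hM => [[c1 _]|[_ hv]]; last first.
  by have [s [/(hamiltonian_connected e_sym)]] := hv x.
by move=> u w; rewrite (card_le1_eqP (A := predT) _ u w) ?c1.
Qed.

End HCTVs.

(** * The inflated cycle *)

Lemma size_sum_count (T : Type) (K : finType) (blk : T -> K) (s : seq T) :
  size s = \sum_C count (fun v => blk v == C) s.
Proof.
elim: s => [|v s IH] /=; first by rewrite big1.
rewrite big_split /= -IH (bigD1 (blk v)) //= eqxx big1 // => C.
by rewrite eq_sym => /negbTE->.
Qed.

(** Adds up a loss of [m] over the indices in [A]; the boolean [A i] counts as 0 or 1. *)
Lemma leq_sum_deficit (I : finType) (A : pred I) (c d : I -> nat) m :
  (forall i, c i + A i * m <= d i) -> \sum_i c i + #|A| * m <= \sum_i d i.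
Proof.
move=> h; apply: leq_trans (leq_sum _ (fun i _ => h i)).
rewrite big_split /= leq_add2l -sum1_card big_distrl /= big_mkcond.
by apply: leq_sum => i _; rewrite mul1n /in_mem /=; case: (A i); rewrite ?mul1n.
Qed.

Section Necklace.
Variables (n m : nat) (k : 'I_n -> nat).
Variables (G : 'I_n -> sgraph) (a b : forall i, G i).
Variables (M : 'I_n -> sgraph) (x y : forall i, M i).
Hypotheses (n2 : 2 <= n) (k_ge : forall i, m + 2 <= k i).
Hypothesis inflG : forall i, inflator (a i) (b i) (k i) m.
Hypothesis hctvM : forall i, HCTV (x i) (y i).
Hypothesis m_le_M : forall i, m <= #|M i|.

Notation F := (FV G M).
Notation e := (Fadj a b x y).

Definition injG i (v : G i) : F := inl (Tagged (fun j => vert (G j)) v).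
Definition injM i (v : M i) : F := inr (Tagged (fun j => vert (M j)) v).

Definition block (v : F) : 'I_n + 'I_n :=
  match v with inl u => inl (tag u) | inr u => inr (tag u) end.
(** The blocks, [inl i] for [G i] and [inr i] for [M i], come in the cyclic order G_0, M_0, G_1,
    M_1, and so on. *)
Definition next (C : 'I_n + 'I_n) : 'I_n + 'I_n :=
  match C with inl i => inr i | inr i => inl (ordS i) end.
Definition prev (C : 'I_n + 'I_n) : 'I_n + 'I_n :=
  match C with inl i => inr (ord_pred i) | inr i => inl i end.
Definition entry (C : 'I_n + 'I_n) : F :=
  match C with inl i => injG (a i) | inr i => injM (x i) end.
Definition exit (C : 'I_n + 'I_n) : F :=
  match C with inl i => injG (b i) | inr i => injM (y i) end.

Lemma adjG i (u w : G i) : e (injG u) (injG w) = adj u w.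
Proof. by rewrite /= eqxx tagged_asE. Qed.

Lemma adjM i (u w : M i) : e (injM u) (injM w) = adj u w.
Proof. by rewrite /= eqxx tagged_asE. Qed.

Lemma injG_inj i : injective (@injG i).
Proof. by move=> u w [] /eqP; rewrite eq_Tagged => /eqP. Qed.

Lemma injM_inj i : injective (@injM i).
Proof. by move=> u w [] /eqP; rewrite eq_Tagged => /eqP. Qed.

Lemma Fadj_sym : symmetric e.
Proof.
move=> [[i u]|[i u]] [[j w]|[j w]] //=; case: eqVneq => //= ij; subst j;
  by rewrite !tagged_asE adj_sym.
Qed.

Lemma nextK : cancel next prev.
Proof. by case=> i //=; rewrite ordSK. Qed.

Lemma prevK : cancel prev next.
Proof. by case=> i //=; rewrite ord_predK. Qed.

Lemma block_entry C : block (entry C) = C. Proof. by case: C. Qed.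
Lemma block_exit C : block (exit C) = C. Proof. by case: C. Qed.

Lemma Fadj_cross u w : e u w -> block u != block w ->
  port next prev entry exit (block u) u w.
Proof.
case: u w => [[i u]|[i u]] [[j w]|[j w]] /=.
- by case: eqVneq => //= ij _ /eqP[]; rewrite ij.
- rewrite /Flink /= => /orP[] /andP[/andP[/eqP ij /eqP-> /eqP->]] _; subst.
    by left.
  by right; rewrite /= ordSK.
- rewrite /Flink /= => /orP[] /andP[/andP[/eqP ij /eqP-> /eqP->]] _; subst.
    by right.
  by left.
by case: eqVneq => //= ij _ /eqP[]; rewrite ij.
Qed.

Lemma Fadj_link C : e (exit C) (entry (next C)).
Proof. by case: C => i; rewrite /= /Flink /= !eqxx ?orbT. Qed.

Lemma next_neq C : next C != C. Proof. by case: C. Qed.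

Lemma ordS_neq (i : 'I_n) : ordS i != i.
Proof.
rewrite -val_eqE /=; have := ltn_ord i; rewrite leq_eqVlt => /predU1P[En|lt].
  by rewrite En modnn; lia.
by rewrite modn_small // neq_ltn ltnSn orbT.
Qed.

(** This rests on [n >= 2]: with a single index, both neighbours of a G-block would be the same
    M-block. *)
Lemma next_neq_prev C : next C != prev C.
Proof.
case: C => i /=; last exact: ordS_neq.
by apply: contra (ordS_neq i) => /eqP[E]; rewrite [X in ordS X]E ord_predK.
Qed.

Lemma next_connected C D : fconnect next C D.
Proof.
have inj_next := can_inj nextK.
pose o : 'I_n := Ordinal (ltnW n2).
have co (D' : 'I_n + 'I_n) : fconnect next (inl o) D'.
  (* Two steps of [next] lead from one G-block to the following one. *)
  have H j (jn : j < n) : fconnect next (inl o) (inl (Ordinal jn)).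
    elim: j jn => [|j IH] jn.
      by rewrite (_ : Ordinal jn = o) //; apply: val_inj.
    apply: connect_trans (IH (ltnW jn)) _.
    rewrite (_ : inl (Ordinal jn) = next (next (inl (Ordinal (ltnW jn))))).
      exact: (fconnect_iter next 2).
    by congr inl; apply: val_inj; rewrite /= modn_small.
  case: D' => -[j jn]; first exact: H.
  by apply: connect_trans (H j jn) _; apply: (fconnect1 next).
by apply: connect_trans (co D); rewrite (fconnect_sym inj_next).
Qed.

Lemma in_blockG i v : block v = inl i -> exists u : G i, v = injG u.
Proof. by case: v => [[j u]|w] //= [E]; subst j; exists u. Qed.

Lemma in_blockM i v : block v = inr i -> exists u : M i, v = injM u.
Proof. by case: v => [w|[j u]] //= [E]; subst j; exists u. Qed.

Lemma blockG_seq i p : (forall v, v \in p -> block v = inl i) ->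
  exists q : seq (G i), p = map (@injG i) q.
Proof.
elim: p => [|v p IH] h; first by exists [::].
have [|q ->] := IH; first by move=> w wp; apply: h; rewrite inE wp orbT.
have [u ->] := in_blockG (h v (mem_head _ _)).
by exists (u :: q).
Qed.

Lemma blockM_seq i p : (forall v, v \in p -> block v = inr i) ->
  exists q : seq (M i), p = map (@injM i) q.
Proof.
elim: p => [|v p IH] h; first by exists [::].
have [|q ->] := IH; first by move=> w wp; apply: h; rewrite inE wp orbT.
have [u ->] := in_blockM (h v (mem_head _ _)).
by exists (u :: q).
Qed.

Lemma sorted_injG i (p : seq (G i)) : sorted e (map (@injG i) p) = sorted (@adj (G i)) p.
Proof. by rewrite sorted_map; apply: eq_sorted => u w; apply: adjG. Qed.

Lemma sorted_injM i (p : seq (M i)) : sorted e (map (@injM i) p) = sorted (@adj (M i)) p.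
Proof. by rewrite sorted_map; apply: eq_sorted => u w; apply: adjM. Qed.

(** * Upper bound on the order of a path *)

Definition visits (s : seq F) C := count (fun v => block v == C) s.
Arguments visits : simpl never.

Lemma visitsG_le s i : uniq s -> visits s (inl i) <= #|G i|.
Proof.
move=> us; rewrite /visits -size_filter.
have [|q Eq] := @blockG_seq i (filter (fun v => block v == inl i) s).
  by move=> v; rewrite mem_filter => /andP[/eqP].
rewrite Eq size_map uniq_size_le // -(map_inj_uniq (@injG_inj i)) -Eq.
exact: filter_uniq.
Qed.

Lemma visitsM_le s i : uniq s -> visits s (inr i) <= #|M i|.
Proof.
move=> us; rewrite /visits -size_filter.
have [|q Eq] := @blockM_seq i (filter (fun v => block v == inr i) s).
  by move=> v; rewrite mem_filter => /andP[/eqP].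
rewrite Eq size_map uniq_size_le // -(map_inj_uniq (@injM_inj i)) -Eq.
exact: filter_uniq.
Qed.

Lemma visits0 s C : (forall v, v \in s -> block v != C) -> visits s C = 0.
Proof.
move=> h; apply/eqP; rewrite /visits -leqn0 leqNgt -has_count.
by apply/hasPn => v /h.
Qed.

Lemma m_le_G i : m <= #|G i|.
Proof. by have [[_ [-> _]] _ _ _ _] := inflG i; have := k_ge i; lia. Qed.

(** Either the block is avoided, and [m <= #|G i|] suffices, or its visited vertices form one path
    between [a i] and [b i], to which (D-1) applies. *)
Lemma visitsG_passing u t i : path_from e u t ->
  block u != inl i -> block (last u t) != inl i ->
  visits (u :: t) (inl i) + m <= #|G i|.
Proof.
move=> pt ui ti.
have [nv|] := path_through_block Fadj_sym Fadj_cross pt ui ti.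
  by rewrite visits0 ?m_le_G.
case=> [s1 [l [c [p [r [s2 [Es pC sC [[p1 p2] lr]]]]]]]].
have /andP[st us] := pt.
have cnt : visits (u :: t) (inl i) = size (c :: p).
  have pe : perm_eq (u :: t) ((c :: p) ++ s1 ++ [:: l, r & s2]).
    by apply/permP => q; rewrite Es /= !count_cat /= count_cat /=; lia.
  rewrite /visits (permP pe) count_cat -!/(visits _ _) (visits0 sC) addn0.
  by apply/eqP; rewrite -all_count; apply/allP => v /pC ->.
rewrite cnt; have [q Eq] := blockG_seq pC.
have sub : infix (c :: p) (u :: t).
  by apply/infixP; exists (s1 ++ [:: l]), (r :: s2); rewrite Es -catA.
have sq : sorted (@adj (G i)) q.
  by rewrite -sorted_injG -Eq; apply: (infix_sorted sub).
have uq : uniq q by rewrite -(map_inj_uniq (@injG_inj i)) -Eq (infix_uniq sub).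
have ho u0 : c = injG u0 -> ohead q = Some u0.
  by case: q Eq {sq uq} => //= z q [-> _] /injG_inj->.
have lo u0 : last c p = injG u0 -> olast q = Some u0.
  case: q Eq {sq uq ho} => //= z q [-> ->].
  by rewrite last_map olast_cons => /injG_inj->.
rewrite Eq size_map; apply: (inflator_cross_le (inflG i)).
case: (ports_distinct p1 p2 lr) => -[cE _ kE _]; [left | right];
  by split=> //; [apply: ho | apply: lo].
Qed.

Definition total := \sum_i #|G i| + \sum_i #|M i|.

Lemma path_size_le u t : path_from e u t -> size (u :: t) + n.-1 * m <= total.
Proof.
move=> pt; have /andP[_ us] := pt.
have -> : size (u :: t) =
    \sum_(i < n) visits (u :: t) (inl i) + \sum_(i < n) visits (u :: t) (inr i).
  by rewrite (size_sum_count block) big_sumType.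
(* If all G-blocks except possibly [i0] are free of ends, the other [n.-1] of them already account
   for the whole loss. *)
have one i0 : (forall j, j != i0 -> block u != inl j /\ block (last u t) != inl j) ->
    \sum_(i < n) visits (u :: t) (inl i) + \sum_(i < n) visits (u :: t) (inr i)
    + n.-1 * m <= total.
  move=> free; rewrite addnAC leq_add //; last first.
    by apply: leq_sum => i _; apply: visitsM_le.
  rewrite -[n in n.-1]card_ord -(cardC1 i0); apply: leq_sum_deficit => i /=.
  have [_|h] := eqVneq i i0; first by rewrite addn0 visitsG_le.
  have [ui ti] := free i h.
  by rewrite mul1n visitsG_passing.
case Eu : (block u) => [i|i]; case El : (block (last u t)) => [j|j].
- have [ij|ij] := eqVneq i j.
    by apply: (one i) => h; rewrite Eu El -ij eq_sym => hi.
  (* Both neighbours of [G i] are M-blocks, so neither contains the last vertex, and one of them is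
     missed entirely. It makes up for having only [n.-2] G-blocks without ends. *)
  have [l lM] : exists l, visits (u :: t) (inr l) = 0.
    have [C|hv|hv] := path_misses_neighbour Fadj_sym nextK prevK block_entry block_exit Fadj_cross
                         next_neq next_neq_prev pt.
    + by rewrite Eu El !inE => /or3P[] /eqP-> //; rewrite eq_sym.
    + by exists i; apply: visits0 => v /hv; rewrite Eu.
    by exists (ord_pred i); apply: visits0 => v /hv; rewrite Eu.
  have hG : \sum_(h < n) visits (u :: t) (inl h) + n.-2 * m <= \sum_h #|G h|.
    have -> : n.-2 = #|predC (pred2 i j)|.
      by have := cardC (pred2 i j); rewrite card2 ij card_ord => /= E; rewrite -[in LHS]E.
    apply: leq_sum_deficit => h /=; have [hi|hi] := eqVneq h i.
      by rewrite addn0 visitsG_le.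
    have [hj|hj] := eqVneq h j; first by rewrite addn0 visitsG_le.
    by rewrite mul1n visitsG_passing // ?Eu ?El eq_sym.
  have hM : \sum_(h < n) visits (u :: t) (inr h) + 1 * m <= \sum_h #|M h|.
    rewrite -(card1 l); apply: leq_sum_deficit => h /=.
    case: eqVneq => [->|_]; first by rewrite lM mul1n.
    by rewrite addn0 visitsM_le.
  have -> : n.-1 = n.-2 + 1 by lia.
  by rewrite mulnDl /total; lia.
- by apply: (one i) => h; rewrite Eu El eq_sym => hi.
- by apply: (one j) => h; rewrite Eu El eq_sym => hi.
(* Both ends lie in M-blocks, so any index can be the exceptional one. *)
by apply: (one (Ordinal (ltnW n2))) => h _; rewrite Eu El.
Qed.

(** Lower bound: such a tour loses exactly [m] vertices in each G-block other than [G i] and none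
    elsewhere. If [p1] is empty, the first vertex of [N i] is unconstrained; if [p2] is empty, so is
    the last vertex of [N (ord_pred i)]. This lets a tour have an end at any vertex of an
    M-block. *)
Lemma necklace_tour i (p1 p2 : seq (G i)) (N : forall j, seq (M j)) :
  sorted (@adj (G i)) p1 -> sorted (@adj (G i)) p2 ->
  uniq (p1 ++ p2) -> size (p1 ++ p2) = #|G i| ->
  (forall j, [/\ sorted (@adj (M j)) (N j), uniq (N j) & size (N j) = #|M j|]) ->
  p1 = [::] \/ (olast p1 = Some (b i) /\ ohead (N i) = Some (x i)) ->
  p2 = [::] \/ (olast (N (ord_pred i)) = Some (y (ord_pred i)) /\
                ohead p2 = Some (a i)) ->
  (forall j, j != i -> ohead (N j) = Some (x j)) ->
  (forall j, ordS j != i -> olast (N j) = Some (y j)) ->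
  exists W, [/\ sorted e W, uniq W, size W + n.-1 * m = total,
    ohead W = (if p1 is [::] then ohead (map (@injM i) (N i))
               else ohead (map (@injG i) p1)) &
    olast W = (if p2 is [::]
               then olast (map (@injM (ord_pred i)) (N (ord_pred i)))
               else olast (map (@injG i) p2))].
Proof.
move=> s1 s2 u12 sz12 hN hp1 hp2 hx hy.
have [H hH] := fin_all_exists (fun j => inflator_cross (inflG j)).
pose seg (D : 'I_n + 'I_n) : seq F := match D with
  | inl j => map (@injG j) (H j) | inr j => map (@injM j) (N j) end.
have segP D : [/\ seg D != [::], sorted e (seg D), uniq (seg D) &
                  forall v, v \in seg D -> block v = D].
  case: D => j /=.
    have [[sH uH hH' _] _] := hH j.
    rewrite sorted_injG (map_inj_uniq (@injG_inj j)); split=> //.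
      by case: (H j) hH'.
    by move=> v /mapP[w _ ->].
  have [sN uN szN] := hN j.
  rewrite sorted_injM (map_inj_uniq (@injM_inj j)); split=> //.
    have /card_gt0P : exists w : M j, w \in predT by exists (x j).
    by rewrite -szN; case: (N j).
  by move=> v /mapP[w _ ->].
have lk C (s t : seq F) : olast s = Some (exit C) -> ohead t = Some (entry (next C)) ->
    linked e s t.
  by move=> hs ht u w; rewrite hs ht => -[<-] [<-]; apply: Fadj_link.
have segx D : D != inr (ord_pred i) -> olast (seg D) = Some (exit D).
  case: D => j /= hj; rewrite olast_map.
    by have [[_ _ _ ->] _] := hH j.
  rewrite hy //; apply: contra hj => /eqP <-; by rewrite ordSK.
have sege D : D != inr i -> ohead (seg D) = Some (entry D).
  case: D => j /= hj; rewrite ohead_map.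
    by have [[_ _ -> _] _] := hH j.
  by rewrite hx.
have [|||||||||| W [sW uW szW hW lW]] :=
  @ring_tour _ _ e block next prev nextK next_neq next_connected seg (inl i)
        (map (@injG i) p1) (map (@injG i) p2).
- by rewrite sorted_injG.
- by rewrite sorted_injG.
- by rewrite -map_cat (map_inj_uniq (@injG_inj i)).
- by move=> v; rewrite -map_cat => /mapP[w _ ->].
- by move=> D _; have [] := segP D.
- by move=> D _; have [] := segP D.
- by move=> D _; have [] := segP D.
- case: hp1 => [->|[lp hp]] //; apply: (lk (inl i)).
    by rewrite olast_map lp.
  by rewrite /= ohead_map hp.
- case: hp2 => [->|[lp hp]]; first by move=> u w.
  apply: (lk (inr (ord_pred i))); first by rewrite /= olast_map lp.
  by rewrite ohead_map hp /= ord_predK.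
- move=> D Di nDi; apply: (lk D).
    apply: segx; apply: contra nDi => /eqP-> /=.
    by rewrite ord_predK.
  apply: sege; apply: contra Di => /eqP/(congr1 prev).
  by rewrite nextK => ->.
exists W; split=> //.
- rewrite szW -map_cat size_map sz12 big_sumType /= /total.
  rewrite [in RHS](bigD1 i) //= -!addnA; congr (_ + _).
  have -> : \sum_(j | j != i) #|G j| =
      \sum_(j | j != i) size (map (@injG j) (H j)) + n.-1 * m.
    rewrite -[n in n.-1]card_ord -(cardC1 i) -sum_nat_const -big_split /=.
    by apply: eq_bigr => j _; rewrite size_map (proj2 (hH j)).
  rewrite -addnA [n.-1 * m + _]addnC; congr (_ + (_ + _)).
  by apply: eq_bigr => j _; rewrite size_map; have [] := hN j.
- by rewrite hW; case: (p1).
by rewrite lW; case: (p2).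
Qed.

Lemma tour_exists v : exists W,
  [/\ sorted e W, uniq W, size W + n.-1 * m = total & ohead W = Some v].
Proof.
(* Reversal makes it enough to have [v] at either end of a tour. *)
suff [W [sW uW szW [hW|lW]]] : exists W,
    [/\ sorted e W, uniq W, size W + n.-1 * m = total &
        ohead W = Some v \/ olast W = Some v].
- by exists W.
- by exists (rev W); rewrite (sorted_revE _ Fadj_sym) rev_uniq size_rev.
have [N hN] := fin_all_exists (fun j => HCTV_cross (hctvM j)).
have N3 j : [/\ sorted (@adj (M j)) (N j), uniq (N j) & size (N j) = #|M j|].
  by have [[]] := hN j.
have Nx j : ohead (N j) = Some (x j) by have [[]] := hN j.
have Ny j : olast (N j) = Some (y j) by have [[]] := hN j.
case: v => -[i v].
  have [p1 [p2 [[s1 s2 u12 sz12] [l1 h2 hv]]]] := inflator_split (inflG i) v.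
  have [||||W [sW uW szW hW lW]] := necklace_tour s1 s2 u12 sz12 N3; auto.
  exists W; split=> //; case: hv => [h1|l2]; [left; rewrite hW | right; rewrite lW].
    by case: p1 h1 {s1 u12 sz12 l1 hW} => //= z p1 [->].
  case/lastP: p2 l2 {s2 u12 sz12 h2 lW} => // p2 z; rewrite olast_rcons => -[->].
  by rewrite map_rcons olast_rcons; case: (p2).
have [p [szp hp]] := HCTV_span (hctvM i) v.
(* [dfwith N p] replaces the chosen path of [M i] by [p], which has [v] as an end. *)
have M3 j : [/\ sorted (@adj (M j)) (dfwith N p j), uniq (dfwith N p j) &
                size (dfwith N p j) = #|M j|].
  by case: dfwithP => //; case: hp => -[].
case: hp => -[_ _ hp lp].
  (* Here [p] runs from [v] to [y i]: the tour starts with it and finishes by covering [G i] from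
     [a i]. *)
  have [q [sq uq szq hq]] := inflator_span_a (inflG i).
  have My j : olast (dfwith N p j) = Some (y j) by case: dfwithP.
  have [||||W [sW uW szW hW _]] := @necklace_tour i [::] q _ isT sq uq szq M3; auto.
    by move=> j ji; rewrite dfwith_out // eq_sym.
  exists W; split=> //; left; rewrite hW dfwith_in.
  by case: (p) hp => //= z q' [->].
(* Here [p] runs from [x i] to [v]: the tour first covers the next block [G (ordS i)], ending at its
   [b], and finishes with [p]. *)
have [q [sq uq szq lq]] := inflator_span_b (inflG (ordS i)).
have Mx j : ohead (dfwith N p j) = Some (x j) by case: dfwithP.
have u0 : uniq (q ++ [::]) by rewrite cats0.
have sz0 : size (q ++ [::]) = #|G (ordS i)| by rewrite cats0.
have [||||W [sW uW szW _ lW]] := @necklace_tour (ordS i) q [::] _ sq isT u0 sz0 M3; auto.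
  move=> j ji; rewrite dfwith_out //; apply: contra ji => /eqP->//.
exists W; split=> //; right; rewrite lW ordSK dfwith_in.
by case/lastP: (p) lp => // q' z; rewrite olast_rcons map_rcons olast_rcons => -[->].
Qed.

(** * The detour, nontraceability and connectedness properties *)

Lemma tau_necklace v : tau e v = total - n.-1 * m.
Proof.
have [W [sW uW szW hW]] := tour_exists v.
apply: tau_eq => [|t pt]; last by have := path_size_le pt; rewrite /=; lia.
case: W sW uW szW hW => //= z t st ut szt [zv]; subst z.
by exists t; rewrite /path_from st /= ut; split=> //; lia.
Qed.

Lemma card_necklace : #|{: F}| = total.
Proof. by rewrite card_sum !card_tagged !sumnE !big_map -!enumT !big_enum. Qed.

(** A hamiltonian path would have [total] vertices, exceeding the upper bound by [n.-1 * m], which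
    is positive. *)
Lemma necklace_nontraceable : 0 < m -> nontraceable e.
Proof.
move=> m0 [v [s [ps full]]]; have := path_size_le ps.
rewrite uniq_size_full // ?card_necklace; last by case/andP: ps.
have : 0 < n.-1 * m by rewrite muln_gt0 m0 andbT; lia.
by lia.
Qed.

Lemma necklace_connected : connected_graph e.
Proof.
have csym := sym_connect_sym Fadj_sym.
have cG i (u w : G i) : connect e (injG u) (injG w).
  have [_ _ _ [[s /(hamiltonian_connected (@adj_sym (G i)))/(_ u w) cuw] _] _] := inflG i.
  case/connectP: cuw => p pth ->; apply/connectP; exists (map (@injG i) p).
    by rewrite path_map (eq_path (e' := @adj (G i))) // => z t; apply: adjG.
  by rewrite last_map.
have cM i (u w : M i) : connect e (injM u) (injM w).
  case/connectP: (HCTV_connected (hctvM i) u w) => p pth ->.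
  apply/connectP; exists (map (@injM i) p).
    by rewrite path_map (eq_path (e' := @adj (M i))) // => z t; apply: adjM.
  by rewrite last_map.
have cB u w : block u = block w -> connect e u w.
  case: u w => [[i u]|[i u]] [[j w]|[j w]] //= [E]; subst j; [exact: cG|exact: cM].
have cN C : connect e (entry C) (entry (next C)).
  apply: connect_trans (connect1 (Fadj_link C)); apply: cB.
  by rewrite block_entry block_exit.
move=> u w; apply: (@connect_trans _ _ (entry (block u))).
  by apply: cB; rewrite block_entry.
apply: (@connect_trans _ _ (entry (block w))); last by apply: cB; rewrite block_entry.
case/connectP: (next_connected (block u) (block w)) => p pth ->.
elim: p (block u) pth => //= D p IH C /andP[/eqP <- pth].
exact: connect_trans (cN C) (IH _ pth).
Qed.

End Necklace.

Theorem theorem2p24 (n m : nat) (k : 'I_n -> nat)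
  (G : 'I_n -> sgraph) (a b : forall i, G i)
  (M : 'I_n -> sgraph) (x y : forall i, M i) :
  2 <= n -> 0 < m -> (forall i, 0 < k i) -> (forall i, m + 2 <= k i) ->
  (forall i, inflator (a i) (b i) (k i) m) ->
  (forall i, HCTV (x i) (y i) /\ m <= #|M i|) ->
  [/\ connected_graph (Fadj a b x y),
      nontraceable (Fadj a b x y) &
      detour_graph (Fadj a b x y)].
Proof.
move=> n2 m0 _ km inflG hM.
have hctvM i : HCTV (x i) (y i) by case: (hM i).
have mM i : m <= #|M i| by case: (hM i).
split.
- exact: necklace_connected n2 inflG hctvM.
- exact: necklace_nontraceable n2 km inflG mM m0.
by move=> u w; rewrite !(tau_necklace n2 km inflG hctvM mM).
Qed.
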